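(* Let $\mathcal{H}$ be a hypergraph. The line multigraph $\mathcal{L}(\mathcal{H})$ is regular if and only if $\mathcal{H}$ is skew edge-regular.
   Context: A hypergraph $\mathcal{H}=(V,E)$ consists of a finite set $V$ of vertices and a set $E$ of non-empty subsets of $V$, called hyperedges. All hypergraphs are assumed simple (no hyperedge has cardinality one and no hyperedge is contained in another) and connected (any two vertices are joined by a path, i.e. an alternating sequence of distinct vertices and hyperedges in which each hyperedge contains the vertices immediately before and after it). The degree $d_{\mathcal{H}}(v)$ of a vertex $v$ is the number of hyperedges containing $v$. The line multigraph $\mathcal{L}(\mathcal{H})$ is the multigraph with vertex set $E$ in which two distinct vertices $e,f\in E$ are joined by exactly $|e\cap f|$ edges (no loops). The degree of a vertex in a multigraph is the number of edges containing it, counted with multiplicity; a multigraph is regular if all its vertices have the same degree. $\mathcal{H}$ is skew edge-regular if there exists a constant $D$ such that $\sum_{v\in e}(d_{\mathcal{H}}(v)-1)=D$ for all $e\in E$. *)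

(* Defs.v *)
From mathcomp Require Import all_boot.

Set Implicit Arguments.
Unset Strict Implicit.
Unset Printing Implicit Defensive.

Record hypergraph := Hypergraph {
  vertex : finType;
  hyperedges : {set {set vertex}};
  hyperedges_nonempty : set0 \notin hyperedges
}.

Definition hdegree (H : hypergraph) (v : vertex H) : nat :=
  #|[set e in hyperedges H | v \in e]|.

Definition simple_hypergraph (H : hypergraph) : Prop :=
  (forall e, e \in hyperedges H -> #|e| != 1) /\
  (forall e f, e \in hyperedges H -> f \in hyperedges H ->
     e \subset f -> e = f).

(* The alternating sequence u, e_1, v_1, ..., e_k, v_k is encoded by its first
   vertex u and the list of pairs (e_i, v_i). *)
Fixpoint alternating (H : hypergraph) (u : vertex H)
    (p : seq ({set vertex H} * vertex H)) : bool :=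
  if p is (e, w) :: p' then
    [&& e \in hyperedges H, u \in e, w \in e & alternating w p']
  else true.

Definition hpath (H : hypergraph) (u : vertex H)
    (p : seq ({set vertex H} * vertex H)) (v : vertex H) : Prop :=
  [/\ alternating u p, last u (unzip2 p) = v,
      uniq (u :: unzip2 p) & uniq (unzip1 p)].

Definition connected_hypergraph (H : hypergraph) : Prop :=
  forall u v : vertex H, exists p, hpath u p v.

(* A loopless multigraph is given by the multiset of its edges: [mult a] is the
   number of edges whose set of endpoints is [a]. *)
Record multigraph := Multigraph {
  mvertex : finType;
  mult : {set mvertex} -> nat;
  mult_card2 : forall a, mult a != 0 -> #|a| = 2
}.

Definition mdegree (G : multigraph) (x : mvertex G) : nat :=
  \sum_(a : {set mvertex G} | x \in a) mult a.

Definition regular_multigraph (G : multigraph) : Prop :=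
  forall x y : mvertex G, mdegree x = mdegree y.

Section LineMultigraph.
Variable H : hypergraph.

Definition line_vertex : finType := {e : {set vertex H} | e \in hyperedges H}.

Definition line_mult (a : {set line_vertex}) : nat :=
  if #|a| == 2 then #|\bigcap_(e in a) val e| else 0.

Fact line_mult_card2 a : line_mult a != 0 -> #|a| = 2.
Proof. by rewrite /line_mult; case: (#|a| =P 2). Qed.

Definition line_multigraph : multigraph := Multigraph line_mult_card2.

Lemma line_multE (e f : line_vertex) : e != f ->
  @mult line_multigraph [set e; f] = #|val e :&: val f|.
Proof.
by move=> nef; rewrite /= /line_mult cards2 nef big_setU1 ?inE //= big_set1.
Qed.

End LineMultigraph.

(* The truncated subtraction is exact here, since v lies in the hyperedge e and
   hence has degree at least 1. *)
Definition skew_edge_regular (H : hypergraph) : Prop :=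
  exists D : nat, forall e, e \in hyperedges H ->
    \sum_(v in e) (hdegree v - 1) = D.

(* Main.v *)
(* Double counting the pairs (v, f) with f <> e a hyperedge and v in both e and
   f shows that the degree of e in the line multigraph is the sum over v in e
   of d(v) - 1; regularity and skew edge-regularity are then the same
   condition. *)
Require Import Defs.
From mathcomp Require Import all_boot.

(** By [mult_card2] only two-element sets carry edges, and for [y != x] the pair [[set x; y]]
    determines [y]. *)
Lemma mdegree_sum_pairs (G : multigraph) (x : mvertex G) :
  mdegree x = \sum_(y | y != x) mult [set x; y].
Proof.
have pair_inj : {in predC1 x &, injective (fun y => [set x; y])}.
  move=> y z; rewrite !inE => nyx _ /setP/(_ y).
  by rewrite !inE eqxx orbT (negPf nyx) => /esym/eqP.
rewrite -(big_imset (mult (m:=G)) pair_inj) /mdegree big_mkcond /=.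
rewrite [RHS]big_mkcond /=; apply: eq_bigr => a _.
case: imsetP => [[y _ ->]|not_pair]; first by rewrite !inE eqxx.
case: ifP => // xa; apply/eqP/negPn/negP => /mult_card2 card_a.
have /cards1P[y ay] : #|a :\ x| == 1.
  by move: card_a; rewrite (cardsD1 x) xa add1n => -[->].
apply: not_pair; exists y; last by rewrite -ay setD1K.
by have := set11 y; rewrite -ay !inE => /andP[].
Qed.

Lemma mdegree_line (H : hypergraph) (x : line_vertex H) :
  mdegree (G := line_multigraph H) x = \sum_(v in val x) (hdegree v - 1).
Proof.
rewrite mdegree_sum_pairs.
(* The size of the intersection becomes a sum over [v] in [val x] of indicators of [v \in val y], so
   that the two sums can be exchanged. *)
under eq_bigr => y nyx.
  rewrite line_multE 1?eq_sym // -sum1_card.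
  under eq_bigl do rewrite inE.
  rewrite big_mkcondr /=; over.
rewrite exchange_big /=; apply: eq_bigr => v vx.
have -> : hdegree v = \sum_(y : line_vertex H) (v \in val y).
  rewrite -big_mkcond sum1_card -(card_imset _ val_inj) /hdegree.
  apply: eq_card => e; rewrite inE; apply/andP/imsetP => [[eH ve]|[y vy ->]].
    by exists (Sub e eH).
  by split; [exact: valP|].
(* The term of [x] itself is 1 because [v] lies in [val x]; it cancels the subtracted 1. *)
rewrite [in RHS](bigD1 x) //= vx addKn.
by apply: eq_bigr => y _; case: (v \in _).
Qed.

Theorem theorem3p6 (H : hypergraph)
  (H_simple : simple_hypergraph H) (H_connected : connected_hypergraph H) :
  regular_multigraph (line_multigraph H) <-> skew_edge_regular H.
Proof.
split=> [reg|[D skew] x y]; last by rewrite !mdegree_line !skew ?(valP x) ?(valP y).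
(* The constant [D] is read off some hyperedge [e0]; if there is none, any value works. *)
have [edgeless|[e0 e0H]] := set_0Vmem (hyperedges H).
  by exists 0 => e; rewrite edgeless inE.
exists (\sum_(v in e0) (hdegree v - 1)) => e eH.
have := reg (Sub e eH) (Sub e0 e0H).
by rewrite !mdegree_line.
Qed.
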